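(* Let $d\in\mathbb{N}$. Then $A_{\mathrm{sym}}(\mathbb{D}^d)$ is a Hermite ring.
   Context: $\mathbb{N}=\{1,2,3,\dots\}$, $\mathbb{D}=\{z\in\mathbb{C}:|z|<1\}$, and $\overline{\mathbb{D}}$ is its closure in $\mathbb{C}$. For $d\in\mathbb{N}$, $A(\mathbb{D}^d)$ is the polydisc algebra of all functions $f:\overline{\mathbb{D}}^d\to\mathbb{C}$ that are holomorphic in $\mathbb{D}^d$ and continuous on $\overline{\mathbb{D}}^d$, with pointwise operations. The symmetric group $S_d$ of all permutations of $\{1,\dots,d\}$ acts by $\sigma\mathbf{z}=(z_{\sigma(1)},\dots,z_{\sigma(d)})$ for $\mathbf{z}=(z_1,\dots,z_d)\in\mathbb{C}^d$. A function $f\in A(\mathbb{D}^d)$ is symmetric if $f(\sigma\mathbf{z})=f(\mathbf{z})$ for all $\mathbf{z}\in\mathbb{D}^d$ and all $\sigma\in S_d$. $A_{\mathrm{sym}}(\mathbb{D}^d)$ is the subalgebra of $A(\mathbb{D}^d)$ consisting of all symmetric functions in $A(\mathbb{D}^d)$. A commutative unital ring $R$ is Hermite if every finitely generated stably free $R$-module is free. A finitely generated $R$-module $M$ is free if $M\simeq R^k$ for some integer $k\geq 0$, and stably free if there exist free finitely generated $R$-modules $F$ and $G$ such that $M\oplus F\simeq G$. *)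

(* Defs.v *)
From HB Require Import structures.
From mathcomp Require Import all_boot all_order all_algebra all_fingroup.
From mathcomp Require Import all_classical all_reals all_analysis.
From mathcomp Require Import complex.
Set Implicit Arguments.
Unset Strict Implicit.
Unset Printing Implicit Defensive.
Import Order.TTheory GRing.Theory Num.Theory.
Import numFieldNormedType.Exports.
Local Open Scope classical_set_scope.
Local Open Scope ring_scope.

Section HermiteRing.
Variable A : comPzRingType.

Definition lmod_iso (M N : lmodType A) : Prop :=
  exists f : {linear M -> N}, bijective f.

Definition finitely_generated (M : lmodType A) : Prop :=
  exists (n : nat) (v : 'I_n -> M),
    forall x : M, exists a : 'I_n -> A, x = \sum_(i < n) a i *: v i.

(* Freeness and stable freeness of finitely generated modules: a free module
   here is one of finite rank. *)
Definition free_module (M : lmodType A) : Prop :=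
  exists k : nat, lmod_iso M 'rV[A]_k.

Definition stably_free_module (M : lmodType A) : Prop :=
  exists F G : lmodType A,
    [/\ free_module F, free_module G & lmod_iso (M * F)%type G].

Definition hermite_ring : Prop :=
  forall M : lmodType A,
    finitely_generated M -> stably_free_module M -> free_module M.

End HermiteRing.

(* R[i] is bundled as a numClosedFieldType so that it receives the normed
   topology that the library puts on every numClosedFieldType. *)
Definition Cplx (R : realType) : numClosedFieldType := R[i].

Lemma near_cst_differentiable (K : numFieldType) (V W : normedModType K)
    (F : V -> W) (c : W) (z : V) :
  (\forall w \near z, F w = c) -> differentiable F z.
Proof.
move=> Fc.
have Fz : F z = c := nbhs_singleton Fc.
have Lc : continuous ('d (cst c : V -> W) z).
  exact/diff_continuous/differentiable_cst.
have L0 : 'd (cst c : V -> W) z = cst 0 :> (V -> W) by rewrite diff_cst.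
have FL : F \o shift z = cst (F z) + 'd (cst c : V -> W) z +o_ 0 id.
  apply/eqaddoP => e e0; move/nbhs0P: Fc; apply: filterS => h Fh.
  rewrite L0 /= !fctE /= Fz [h + z]addrC Fh addr0 subrr normr0.
  by rewrite mulr_ge0 // ltW.
by apply/diff_locallyP; rewrite (diff_unique Lc FL).
Qed.

Section PolydiscAlgebra.
Variables (R : realType) (d : nat).
Local Notation C := (Cplx R).

Definition unit_disc : set C := [set z | `|z| < 1].

Definition polydisc : set 'rV[C]_d :=
  [set z | forall i, unit_disc (z ord0 i)].

Definition closed_polydisc : set 'rV[C]_d :=
  [set z | forall i, closure unit_disc (z ord0 i)].

Lemma polydisc_closed : polydisc `<=` closed_polydisc.
Proof. by move=> z zD i; apply: subset_closure; exact: zD. Qed.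

Lemma closed_polydisc0 : (0 : 'rV[C]_d) \in closed_polydisc.
Proof.
by apply/mem_set/polydisc_closed => i; rewrite /unit_disc /= mxE normr0 ltr01.
Qed.

HB.instance Definition _ :=
  isPointed.Build (set_type closed_polydisc)
    (exist (fun z => z \in closed_polydisc) 0 closed_polydisc0).

(* ['valL_0 f] extends f by 0 outside the closed polydisc. Differentiability
   at a point of the open polydisc does not depend on that extension. *)
Definition holomorphic_in_polydisc (f : closed_polydisc -> C) : Prop :=
  forall z, polydisc z -> differentiable ('valL_0 f) z.

Definition polydisc_algebra : set (closed_polydisc -> C) :=
  [set f | holomorphic_in_polydisc f /\ continuous f].

(* [col_perm s z] is (z_{s(1)}, ..., z_{s(d)}). *)
Definition symmetric_fun (f : closed_polydisc -> C) : Prop :=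
  forall (z : 'rV[C]_d) (s : 'S_d), polydisc z ->
    'valL_0 f (col_perm s z) = 'valL_0 f z.

Definition sym_polydisc_set : set (closed_polydisc -> C) :=
  [set f | polydisc_algebra f /\ symmetric_fun f].

Lemma polydisc_nbhs z : polydisc z -> nbhs z polydisc.
Proof.
move=> zD.
have disc_nbhs i : nbhs (z ord0 i) unit_disc; last first.
  apply: (@filter_forall _ 'I_d (fun i (w : 'rV[C]_d) => unit_disc (w ord0 i))
    (nbhs z) _).
  by move=> i; exact: (@coord_continuous C 1 d ord0 i z _ (disc_nbhs i)).
have -> : unit_disc = ball (0 : C) 1.
  by apply/seteqP; split=> x; rewrite -ball_normE /= sub0r normrN.
apply: open_nbhs_nbhs; split; first exact: ball_open.
by rewrite -ball_normE /= sub0r normrN; exact: zD.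
Qed.

Lemma differentiable_const_on_polydisc (F : 'rV[C]_d -> C) (c : C) z :
  polydisc z -> (forall w, polydisc w -> F w = c) -> differentiable F z.
Proof.
move=> zD Fc.
apply: (near_cst_differentiable (c := c)).
by apply: filterS (polydisc_nbhs zD).
Qed.

Lemma valL0E (f : closed_polydisc -> C) z :
  'valL_0 f z = if insub z is Some a then f a else 0.
Proof. by rewrite /valL_ oinv_set_val /=; case: insub. Qed.

Lemma valL_in (f : closed_polydisc -> C) z (zD : z \in closed_polydisc) :
  'valL_0 f z = f (exist _ z zD).
Proof.
by have /(congr1 (@^~ (exist _ z zD))) := valLK 0 f; rewrite /sigL /= => <-.
Qed.

Lemma valL0B (f g : closed_polydisc -> C) :
  'valL_0 (f - g) = 'valL_0 f \- 'valL_0 g :> ('rV[C]_d -> C).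
Proof.
apply/funext => z; rewrite -[RHS]/('valL_0 f z - 'valL_0 g z) !valL0E.
by case: insub => //=; rewrite subr0.
Qed.

Lemma valL0M (f g : closed_polydisc -> C) :
  'valL_0 (f * g) = 'valL_0 f * 'valL_0 g :> ('rV[C]_d -> C).
Proof.
apply/funext => z; rewrite -[RHS]/('valL_0 f z * 'valL_0 g z) !valL0E.
by case: insub => //=; rewrite mul0r.
Qed.

Lemma valL1_in z : polydisc z ->
  'valL_0 (1 : closed_polydisc -> C) z = 1.
Proof. by move=> /polydisc_closed /mem_set zD; rewrite (valL_in _ zD). Qed.

Fact sym_polydisc_subring_closed :
  subring_closed (mem sym_polydisc_set : {pred closed_polydisc -> C}).
Proof.
split=> [|f g /set_mem[[hf cf] sf] /set_mem[[hg cg] sg]|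
          f g /set_mem[[hf cf] sf] /set_mem[[hg cg] sg]]; apply/mem_set; split.
- split; last exact: cst_continuous.
  move=> z zD; apply: (@differentiable_const_on_polydisc _ 1) => // w wD.
  exact: valL1_in.
- move=> z s zD; rewrite !valL1_in// => i; rewrite mxE; exact: zD.
- split; last by move=> x; exact: (cvgB (cf x) (cg x)).
  by move=> z zD; rewrite valL0B; apply: differentiableB;
    [exact: hf | exact: hg].
- move=> z s zD; rewrite !valL0B.
  exact: (congr2 (fun a b => a - b) (sf z s zD) (sg z s zD)).
- split; last by move=> x; exact: (cvgM (cf x) (cg x)).
  by move=> z zD; rewrite valL0M; apply: differentiableM;
    [exact: hf | exact: hg].
- move=> z s zD; rewrite !valL0M.
  exact: (congr2 (fun a b => a * b) (sf z s zD) (sg z s zD)).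
Qed.

Definition sym_polydisc_algebra : Type := set_type sym_polydisc_set.

HB.instance Definition _ := SubChoice.on sym_polydisc_algebra.
HB.instance Definition _ :=
  GRing.SubChoice_isSubComNzRing.Build (closed_polydisc -> C)
    (fun f => f \in sym_polydisc_set) sym_polydisc_algebra
    sym_polydisc_subring_closed.

End PolydiscAlgebra.

(* Main.v *)
Require Import Defs.
From HB Require Import structures.
From mathcomp Require Import all_boot all_order all_algebra.
From mathcomp Require Import all_classical all_reals all_analysis.
From mathcomp Require Import complex lra.
Set Implicit Arguments.
Unset Strict Implicit.
Unset Printing Implicit Defensive.
Import Order.TTheory GRing.Theory Num.Theory.
Import numFieldNormedType.Exports.
Local Open Scope classical_set_scope.
Local Open Scope ring_scope.

(** Every idempotent matrix P over the symmetric polydisc algebra A is similar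
    to a constant one, because the closed polydisc contracts to its centre
    through the dilations z |-> t z, which commute with the permutations of the
    coordinates and so act on A.

    Let P_t(z) = P(t z) for t in [0, 1]. This is a path of idempotents from the
    constant P_0 to P_1 = P. Put U = P_t P_s + (1 - P_t)(1 - P_s). Then
    P_t U = U P_s, so P_t and P_s are similar over A as soon as U is invertible
    over A, that is, as soon as its determinant is a unit of A. A function in A
    without zeros on the closed polydisc is a unit, its inverse being again
    holomorphic, continuous and symmetric ([nonvanishing_inverse]). For s = t
    the determinant is 1, and by compactness of the closed polydisc it has no
    zeros for s near t ([near_transition_nonvanishing]). The similarity class
    of P_t is thus locally constant in t, hence constant since [0, 1] is
    connected.

    The constant idempotent P_0 is a matrix over a field, so it factors as
    P_0 = B D with D B = 1; the similarity carries this factorization over to P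
    ([idempotent_splits]). A stably free module is a retract of some A^n, i.e.
    the image of an idempotent matrix, and such a factorization of the matrix
    is an isomorphism of the module with A^k ([hermite_of_splits]). *)

(** * Split idempotent matrices and stably free modules *)

Section SplitMatrices.
Variable A : comPzRingType.

(** For an idempotent matrix P this says that its image, a direct summand of the
    free module of rows, is free: the rows of D form a basis of it. *)
Definition splits n (P : 'M[A]_n) : Prop :=
  exists (k : nat) (B : 'M[A]_(n, k)) (D : 'M[A]_(k, n)),
    P = B *m D /\ D *m B = 1%:M.

Lemma stably_free_retract (M : lmodType A) : stably_free_module M ->
  exists (n : nat) (i : {linear M -> 'rV[A]_n}) (p : {linear 'rV[A]_n -> M}),
    cancel i p.
Proof.
move=> [F [G [_ [n [h [h' hK h'K]]] [f [f' fK f'K]]]]].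
have linear_i : linear (fun x : M => h (f (x, 0 : F))).
  move=> a x y; rewrite -!linearP; congr (h (f _)).
  by congr pair; rewrite /= scaler0 addr0.
have linear_h' : linear h'.
  by move=> a x y; apply: (can_inj hK); rewrite linearP !h'K.
have linear_f' : linear f'.
  by move=> a x y; apply: (can_inj fK); rewrite linearP !f'K.
have linear_p : linear (fun v : 'rV[A]_n => (f' (h' v)).1).
  by move=> a x y; rewrite linear_h' linear_f'.
pose i : {linear M -> 'rV[A]_n} := HB.pack (fun x : M => h (f (x, 0 : F)))
  (GRing.isLinear.Build _ _ _ _ _ linear_i).
pose p : {linear 'rV[A]_n -> M} := HB.pack (fun v : 'rV[A]_n => (f' (h' v)).1)
  (GRing.isLinear.Build _ _ _ _ _ linear_p).
exists n, i, p.
by move=> x /=; rewrite hK fK.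
Qed.

(** If i and p exhibit M as a retract, the idempotent i p has image M, and a
    splitting i p = B D provides the mutually inverse maps x |-> i x B and
    y |-> p (y D). *)
Lemma hermite_of_splits :
  (forall n (P : 'M[A]_n), P *m P = P -> splits P) -> hermite_ring A.
Proof.
move=> splitA M _ /stably_free_retract[n [i [p ipK]]].
pose P := lin1_mx (i \o p).
have PE u : u *m P = i (p u) by rewrite mul_rV_lin1.
have PP : P *m P = P.
  by apply/row_matrixP => j; rewrite !row_mul !rowE !PE ipK.
have [k [B [D [PBD DB1]]]] := splitA n P PP.
have iP x : i x *m P = i x by rewrite PE ipK.
exists k.
have linear_b : linear (fun x : M => i x *m B).
  by move=> a x y; rewrite linearP mulmxDl scalemxAl.
pose b : {linear M -> 'rV[A]_k} :=
  HB.pack (fun x : M => i x *m B) (GRing.isLinear.Build _ _ _ _ _ linear_b).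
exists b, (fun y => p (y *m D)) => [x|y] /=.
  by rewrite -mulmxA -PBD iP ipK.
by rewrite -PE PBD !mulmxA -[y *m D *m B]mulmxA DB1 mulmx1 -mulmxA DB1 mulmx1.
Qed.

(** It intertwines two idempotents P and Q, sending the image of P to that of Q
    and the kernel of P to that of Q, and it is the identity when P = Q; hence
    close idempotents are similar. *)
Definition transition n (P Q : 'M[A]_n) : 'M[A]_n :=
  P *m Q + (1%:M - P) *m (1%:M - Q).

Lemma transition_id n (P : 'M[A]_n) : P *m P = P -> transition P P = 1%:M.
Proof.
move=> PP; rewrite /transition mulmxBl mul1mx mulmxBr mulmx1 PP subrr subr0.
by rewrite addrC subrK.
Qed.

Lemma splits_conj n (P Q U V : 'M[A]_n) :
  U *m V = 1%:M -> V *m U = 1%:M -> P *m U = U *m Q -> splits P <-> splits Q.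
Proof.
move=> UV VU PU; split=> [[k [B [D [PE DB]]]]|[k [B [D [QE DB]]]]].
  exists k, (V *m B), (D *m U); split; last first.
    by rewrite !mulmxA -[D *m U *m V]mulmxA UV mulmx1.
  by rewrite !mulmxA -[V *m B *m D]mulmxA -PE -mulmxA PU mulmxA VU mul1mx.
exists k, (U *m B), (D *m V); split; last first.
  by rewrite !mulmxA -[D *m V *m U]mulmxA VU mulmx1.
by rewrite !mulmxA -[U *m B *m D]mulmxA -QE -PU -mulmxA UV mulmx1.
Qed.

Lemma transition_intertwines n (P Q : 'M[A]_n) : P *m P = P -> Q *m Q = Q ->
  P *m transition P Q = transition P Q *m Q.
Proof.
move=> PP QQ.
have P0 : P *m (1%:M - P) = 0 by rewrite mulmxBr mulmx1 PP subrr.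
have Q0 : (1%:M - Q) *m Q = 0 by rewrite mulmxBl mul1mx QQ subrr.
rewrite /transition mulmxDr [RHS]mulmxDl !mulmxA PP P0 mul0mx addr0.
by rewrite -mulmxA QQ -mulmxA Q0 mulmx0 addr0.
Qed.

(** The transition matrix has the inverse v adj U, so it is a similarity. *)
Lemma splits_transition n (P Q : 'M[A]_n) (v : A) :
  P *m P = P -> Q *m Q = Q -> \det (transition P Q) * v = 1 ->
  splits P <-> splits Q.
Proof.
move=> PP QQ dv; set U := transition P Q.
apply: (@splits_conj _ _ _ U (v *: \adj U)).
- by rewrite -scalemxAr mul_mx_adj scale_scalar_mx mulrC dv.
- by rewrite -scalemxAl mul_adj_mx scale_scalar_mx mulrC dv.
- exact: transition_intertwines.
Qed.

End SplitMatrices.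

(** A rank factorization P = B D satisfies B (D B) D = B D when P is idempotent;
    cancelling B on the left and D on the right leaves D B = 1. *)
Lemma field_splits (F : fieldType) n (P : 'M[F]_n) : P *m P = P -> splits P.
Proof.
move=> PP; exists (\rank P), (col_base P), (row_base P).
move: (mulmx_base P) (row_base_free P) (col_base_full P).
move: (col_base P) (row_base P) => B D BD D_free B_full; split=> //.
apply: (row_free_inj D_free); apply: (row_full_inj B_full) => /=.
by rewrite mul1mx -mulmxA mulmxA !BD.
Qed.

Lemma splits_map (A B : comPzRingType) (f : {rmorphism A -> B}) n
    (P : 'M[A]_n) :
  splits P -> splits (map_mx f P).
Proof.
move=> [k [C [D [-> DC]]]]; exists k, (map_mx f C), (map_mx f D).
split; first exact: map_mxM.
by rewrite -map_mxM DC map_mx1.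
Qed.

(** * Two topological principles *)

Lemma compact_set_type (T : topologicalType) (K : set T) :
  compact K -> compact [set: set_type K].
Proof.
move=> /compact_near_coveringP/near_covering_withinP cK.
apply/compact_near_coveringP => J F P FF near_P.
suff : \near F, K `<=` (fun x => forall xK : x \in K, P F (exist _ x xK)).
  apply: filterS => i KP [x xK] _; apply: (KP x _ xK); exact: set_mem.
apply: cK => x /mem_set xK.
have [[U V] [/= [W [[W' oW' <-] /= W'x] WU] FV UVP]] := near_P (exist _ x xK) I.
exists (W', V); first by split=> //; apply: open_nbhs_nbhs.
by move=> [y i] /= [W'y Vi] _ yK; apply: (UVP (_, i)); split=> //; apply: WU.
Qed.

Lemma locally_constant_segment (R : realType) (S : set R) (a b : R) :
  a <= b -> (forall t, \forall s \near t, S s <-> S t) -> S a -> S b.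
Proof.
move=> ab locS Sa.
have oS : open S.
  by rewrite openE => t St; apply: filterS (locS t) => s [_]; apply.
have cS : closed S.
  rewrite -[S]setCK; apply: open_closedC; rewrite openE => t St.
  by apply: filterS (locS t) => s [sS _] /sS.
have abS : `[a, b]%classic `&` S = `[a, b]%classic.
  apply: (@segment_connected R a b); [|by exists S..].
  by exists a; split=> //=; rewrite in_itv /= lexx.
suff : (`[a, b]%classic `&` S) b by case.
by rewrite abS /= in_itv /= lexx andbT.
Qed.

(** * Compactness of the closed unit disc *)

Section ComplexTopology.
Variable R : realType.
Local Notation C := (Cplx R).

Definition real_embedding (t : R) : C := (t%:C)%C.

Lemma continuous_real_embedding : continuous real_embedding.
Proof.
move=> t; apply/cvgrPdist_lt => e e0.
(* The order on C makes every positive e real, so the bound can be read in R. *)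
have [Re0 eE] : 0 < complex.Re e /\ e = real_embedding (complex.Re e).
  case: e e0 => a b; rewrite ltcE /= => /andP[/eqP -> a0]; split=> //.
near=> s.
rewrite /real_embedding -rmorphB normc_def /= expr0n addr0 sqrtr_sqr eE ltcR.
near: s; exact: cvgr_dist_lt.
Unshelve. all: by end_near. Qed.

(** The disc lies in the image of the square [-1, 1]^2 under (a, b) |-> a + i b,
    and this image is compact, hence closed. *)
Lemma compact_closed_unit_disc : compact (closure (@unit_disc R)).
Proof.
pose sq : set (R * R) := `[-1, 1]%classic `*` `[-1, 1]%classic.
pose g (p : R * R) : C := real_embedding p.1 + ('i%C : C) * real_embedding p.2.
have cg : continuous g.
  move=> p; apply: cvgD.
    apply: (@continuous_comp _ _ _ fst real_embedding); first exact: cvg_fst.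
    exact: continuous_real_embedding.
  apply: cvgM; first exact: cvg_cst.
  apply: (@continuous_comp _ _ _ snd real_embedding); first exact: cvg_snd.
  exact: continuous_real_embedding.
have csq : compact (g @` sq).
  apply: continuous_compact; first exact: continuous_subspaceT.
  by apply: compact_setX; exact: segment_compact.
have sub : @unit_disc R `<=` g @` sq.
  move=> [a b]; rewrite /unit_disc /= normc_def ltcR -[X in _ < X]sqrtr1.
  rewrite ltr_sqrt // => ab1.
  exists (a, b); last by rewrite /g [RHS]complexE.
  by split; rewrite /= in_itv /=; move: ab1 => /= ab1; apply/andP; split; nra.
apply: (subclosed_compact (@closed_closure _ _) csq).
rewrite [X in _ `<=` X](closure_id _).1; first exact: closureS.
exact: (compact_closed (@norm_hausdorff _ _)).
Qed.

End ComplexTopology.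

(** * Differentiability is local *)

(** The difference of two functions that agree near z is locally constant, so
    its differentiability is already known. *)
Lemma near_eq_differentiable (K : numFieldType) (V W : normedModType K)
    (F G : V -> W) (z : V) :
  (\forall w \near z, F w = G w) -> differentiable G z -> differentiable F z.
Proof.
move=> FG dG; rewrite (_ : F = (F \- G) \+ G); last first.
  by apply/funext => w /=; rewrite subrK.
apply: differentiableD dG; apply: (@near_cst_differentiable _ _ _ _ 0).
by apply: filterS FG => w /= ->; rewrite subrr.
Qed.

(** * Matrices depending continuously on a point *)

Section ContinuousMatrix.
Variables (K : numFieldType) (T : topologicalType).

Definition mx_continuous m n (M : T -> 'M[K]_(m, n)) : Prop :=
  forall i j, continuous (fun x => M x i j).

Lemma mx_continuousD m n (M N : T -> 'M[K]_(m, n)) :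
  mx_continuous M -> mx_continuous N -> mx_continuous (fun x => M x + N x).
Proof.
move=> cM cN i j x; under eq_fun do rewrite mxE.
by apply: cvgD; [exact: cM | exact: cN].
Qed.

Lemma mx_continuous_1B n (M : T -> 'M[K]_n) :
  mx_continuous M -> mx_continuous (fun x => 1%:M - M x).
Proof.
move=> cM i j x; under eq_fun do rewrite !mxE.
by apply: cvgB; [exact: cvg_cst | exact: cM].
Qed.

Lemma mx_continuousM m n p (M : T -> 'M[K]_(m, n)) (N : T -> 'M[K]_(n, p)) :
  mx_continuous M -> mx_continuous N -> mx_continuous (fun x => M x *m N x).
Proof.
move=> cM cN i j; under eq_fun do rewrite mxE.
apply: (@continuous_big K _ _ 0 _ (@add_continuous K)) => k _ x.
by apply: cvgM; [exact: cM | exact: cN].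
Qed.

Lemma continuous_det n (M : T -> 'M[K]_n) :
  mx_continuous M -> continuous (fun x => \det (M x)).
Proof.
move=> cM; apply: (@continuous_big K _ _ 0 _ (@add_continuous K)) => s _ x.
apply: cvgM; first exact: cvg_cst.
apply: (@continuous_big K 'I_n (fun a b => a * b) 1 predT); last first.
  by move=> i _; exact: cM.
exact: mul_continuous.
Qed.

Lemma mx_continuous_transition n (M N : T -> 'M[K]_n) :
  mx_continuous M -> mx_continuous N ->
  mx_continuous (fun x => transition (M x) (N x)).
Proof.
move=> cM cN; apply: mx_continuousD; first exact: mx_continuousM.
by apply: mx_continuousM; exact: mx_continuous_1B.
Qed.

End ContinuousMatrix.

(** * Dilations of the closed polydisc *)

Section Dilation.
Variables (R : realType) (d : nat).
Local Notation C := (Cplx R).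
Local Notation K := (@closed_polydisc R d).
Local Notation A := (sym_polydisc_algebra R d).

Lemma compact_closed_polydisc : compact [set: K].
Proof.
apply: compact_set_type.
by apply: (@rV_compact C d (fun=> closure (@unit_disc R))) => _;
  exact: compact_closed_unit_disc.
Qed.

(** Clamping the parameter to [0, 1] makes the dilation by this ratio a total
    function of a real parameter, so that continuity in the parameter can be
    stated on the whole real line. *)
Definition ratio (t : R) : C := real_embedding (Num.max 0 (Num.min t 1)).

Lemma ratio0 : ratio 0 = 0.
Proof. by rewrite /ratio min_l // maxxx. Qed.

Lemma ratio1 : ratio 1 = 1.
Proof. by rewrite /ratio minxx max_r. Qed.

Lemma norm_ratio_le1 t : `|ratio t| <= 1.
Proof.
rewrite /ratio normc_def /= expr0n addr0 sqrtr_sqr lecR ger0_norm.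
  by rewrite ge_max ler01 ge_min lexx orbT.
by rewrite le_max lexx.
Qed.

Lemma continuous_ratio : continuous ratio.
Proof.
pose clamp (s : R) : R := Num.max 0 (Num.min s 1).
have clamp_cont : continuous clamp.
  move=> t; apply: (@continuous_max R R (fun=> 0) (fun s => Num.min s 1)).
    exact: cvg_cst.
  by apply: (@continuous_min R R id (fun=> 1)); [exact: cvg_id|exact: cvg_cst].
move=> t; apply: (@continuous_comp _ _ _ clamp (@real_embedding R)).
  exact: clamp_cont.
exact: continuous_real_embedding.
Qed.

Lemma polydiscZ (c : C) (z : 'rV[C]_d) :
  `|c| <= 1 -> polydisc z -> polydisc (c *: z).
Proof.
move=> c1 zD i; rewrite /unit_disc /= mxE normrM.
by apply: le_lt_trans (zD i); rewrite ler_piMl.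
Qed.

Lemma closed_polydiscZ (c : C) (z : 'rV[C]_d) :
  `|c| <= 1 -> closed_polydisc z -> closed_polydisc (c *: z).
Proof.
move=> c1 zK i; rewrite mxE => B Bcz.
have [w [w1 Bcw]] := zK i _ (@scaler_continuous C C c _ _ Bcz).
exists (c * w); split=> //; rewrite /unit_disc /= normrM.
by apply: le_lt_trans w1; rewrite ler_piMl.
Qed.

Fact dilate_subproof (t : R) (z : K) : ratio t *: val z \in K.
Proof.
apply/mem_set/closed_polydiscZ; first exact: norm_ratio_le1.
by case: z => z /= /set_mem.
Qed.

Definition dilate (t : R) (z : K) : K :=
  exist (fun z : 'rV[C]_d => z \in K) _ (dilate_subproof t z).

Lemma dilate1 z : dilate 1 z = z.
Proof. by apply/val_inj; rewrite /= ratio1 scale1r. Qed.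

Lemma dilate0 z : dilate 0 z = point.
Proof. by apply/val_inj; rewrite /= ratio0 scale0r. Qed.

Lemma continuous_dilate : continuous (fun p : K * R => dilate p.2 p.1).
Proof.
apply: (@continuous_comp_initial K _ _ val) => p.
apply: cvgZ.
  apply: (@continuous_comp _ _ _ snd ratio); first exact: cvg_snd.
  exact: continuous_ratio.
apply: (@continuous_comp _ _ _ fst (val : K -> _)); first exact: cvg_fst.
exact: initial_continuous.
Qed.

Lemma continuous_dilate_fixed t : continuous (dilate t).
Proof.
apply: (@continuous_comp_initial K _ _ val) => z.
apply: (@continuous_comp _ _ _ (val : K -> _) ( *:%R (ratio t))).
  exact: initial_continuous.
exact: scaler_continuous.
Qed.

Lemma valL0_dilate (f : K -> C) t z : polydisc z ->
  'valL_0 (f \o dilate t) z = 'valL_0 f (ratio t *: z).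
Proof.
move=> zD; have zK := mem_set (polydisc_closed zD).
have tzK := dilate_subproof t (exist (fun z : 'rV[C]_d => z \in K) z zK).
by rewrite (valL_in _ zK) (valL_in _ tzK) /=; congr f; apply/val_inj.
Qed.

(** * Dilations, evaluations and constants as ring morphisms *)

Fact dilate_in_sym (f : A) t : val f \o dilate t \in @sym_polydisc_set R d.
Proof.
have /set_mem[[hol_f cont_f] sym_f] := valP f.
have rD := @polydiscZ (ratio t) _ (norm_ratio_le1 t).
apply/mem_set; split; first split.
- move=> z zD; apply: (@near_eq_differentiable _ _ _ _
      ('valL_0 (val f) \o ( *:%R (ratio t)))).
    by apply: filterS (polydisc_nbhs zD) => w wD; exact: valL0_dilate.
  apply: differentiable_comp; last exact/hol_f/rD.
  exact/linear_differentiable/scaler_continuous.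
- move=> z; apply: (@continuous_comp _ _ _ (dilate t) (val f)).
    exact: continuous_dilate_fixed.
  exact: cont_f.
- move=> z s zD.
  have sD : polydisc (col_perm s z) by move=> i; rewrite mxE; exact: zD.
  rewrite (valL0_dilate _ _ sD) (valL0_dilate _ _ zD).
  rewrite (_ : _ *: col_perm s z = col_perm s (ratio t *: z)).
    exact/sym_f/rD.
  by apply/rowP => i; rewrite !mxE.
Qed.

Definition precomp_dilate t (f : A) : A :=
  exist (fun f : K -> C => f \in sym_polydisc_set (d:=d)) _ (dilate_in_sym f t).

Fact precomp_dilate_zmod t : zmod_morphism (precomp_dilate t).
Proof. by move=> f g; exact/val_inj. Qed.

Fact precomp_dilate_monoid t : GRing.monoid_morphism (precomp_dilate t).
Proof. by split=> [|f g]; exact/val_inj. Qed.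

HB.instance Definition _ t :=
  GRing.isZmodMorphism.Build A A (precomp_dilate t) (precomp_dilate_zmod t).
HB.instance Definition _ t :=
  GRing.isMonoidMorphism.Build A A (precomp_dilate t) (precomp_dilate_monoid t).

Definition evaluation (z : K) (f : A) : C := val f z.

Fact evaluation_zmod z : zmod_morphism (evaluation z).
Proof. by []. Qed.

Fact evaluation_monoid z : GRing.monoid_morphism (evaluation z).
Proof. by []. Qed.

HB.instance Definition _ z :=
  GRing.isZmodMorphism.Build A C (evaluation z) (evaluation_zmod z).
HB.instance Definition _ z :=
  GRing.isMonoidMorphism.Build A C (evaluation z) (evaluation_monoid z).

Fact constant_in_sym (c : C) : (fun=> c) \in @sym_polydisc_set R d.
Proof.
have valL_c z : polydisc z -> 'valL_0 ((fun=> c) : K -> C) z = c.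
  by move=> /polydisc_closed/mem_set zK; rewrite (valL_in _ zK).
apply/mem_set; split; first split.
- by move=> z zD; exact: (differentiable_const_on_polydisc zD valL_c).
- exact: cst_continuous.
- by move=> z s zD; rewrite !valL_c // => i; rewrite mxE; exact: zD.
Qed.

Definition constant (c : C) : A :=
  exist (fun f : K -> C => f \in sym_polydisc_set (d:=d)) _ (constant_in_sym c).

Fact constant_zmod : zmod_morphism constant.
Proof. by move=> f g; exact/val_inj. Qed.

Fact constant_monoid : GRing.monoid_morphism constant.
Proof. by split=> [|f g]; exact/val_inj. Qed.

HB.instance Definition _ :=
  GRing.isZmodMorphism.Build C A constant constant_zmod.
HB.instance Definition _ :=
  GRing.isMonoidMorphism.Build C A constant constant_monoid.

(** * Splitting of idempotents over the symmetric polydisc algebra *)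

Lemma nonvanishing_inverse (w : A) : (forall z, evaluation z w != 0) ->
  exists v : A, w * v = 1.
Proof.
move=> w0; have /set_mem[[hol_w cont_w] sym_w] := valP w.
pose v (z : K) := (val w z)^-1.
have vE z : 'valL_0 v z = ('valL_0 (val w) z)^-1.
  by rewrite !valL0E; case: insub => //=; rewrite invr0.
have v_sym : v \in @sym_polydisc_set R d.
  apply/mem_set; split; first split.
  - move=> z zD; rewrite (_ : 'valL_0 v = fun z => ('valL_0 (val w) z)^-1).
      apply: differentiableV; first exact: hol_w.
      by rewrite (valL_in _ (mem_set (polydisc_closed zD))); exact: w0.
    exact/funext.
  - move=> z; exact: (cvgV (w0 z) (cont_w z)).
  - by move=> z s zD; rewrite !vE sym_w.
exists (exist (fun f : K -> C => f \in sym_polydisc_set (d:=d)) v v_sym).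
apply/val_inj/funext => z.
exact: (mulfV (w0 z)).
Qed.

(** The determinant is jointly continuous in (z, s) and equals 1 at s = t for
    every z; compactness makes the neighbourhood of t uniform in z. *)
Lemma near_transition_nonvanishing n (P : 'M[A]_n) (t : R) : P *m P = P ->
  \forall s \near t, forall z, evaluation z (\det (transition
    (map_mx (precomp_dilate t) P) (map_mx (precomp_dilate s) P))) != 0.
Proof.
move=> PP.
pose ev (z : K) := map_mx (evaluation z) P.
pose G (p : K * R) :=
  \det (transition (ev (dilate t p.1)) (ev (dilate p.2 p.1))).
have EG z s : evaluation z (\det (transition
    (map_mx (precomp_dilate t) P) (map_mx (precomp_dilate s) P))) = G (z, s).
  rewrite -det_map_mx /G /transition map_mxD !map_mxM !map_mxB !map_mx1.
  by rewrite -!map_mx_comp.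
have cont_ev : mx_continuous ev.
  move=> i j; under eq_fun do rewrite mxE.
  by have /set_mem[[_ cont_Pij] _] := valP (P i j).
have contG : continuous G.
  have cont_t : continuous (fun p : K * R => dilate t p.1).
    move=> p; apply: (@continuous_comp _ _ _ fst (dilate t)).
      exact: cvg_fst.
    exact: continuous_dilate_fixed.
  apply: continuous_det; apply: mx_continuous_transition => i j p.
    exact: (continuous_comp (cont_t p) (cont_ev i j _)).
  exact: (continuous_comp (@continuous_dilate p) (cont_ev i j _)).
have /compact_near_coveringP covK := compact_closed_polydisc.
suff : \near t, [set: K] `<=` (fun z => G (z, t) != 0).
  by apply: filterS => s Gs z; rewrite EG; exact: Gs.
apply: (covK R (nbhs t) (fun s z => G (z, s) != 0)) => z _.
have Gzt : G (z, t) != 0.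
  by rewrite /G /= transition_id ?det1 ?oner_neq0 // -map_mxM PP.
exact: (cvgr_neq0 (G (z, t)) (contG (z, t)) Gzt).
Qed.

(** Being split is invariant under similarity, so it is locally constant along
    the path of dilated matrices and passes from the constant matrix at 0 to
    the given matrix at 1. *)
Lemma idempotent_splits n (P : 'M[A]_n) : P *m P = P -> splits P.
Proof.
move=> PP.
have idem (t : R) : map_mx (precomp_dilate t) P *m map_mx (precomp_dilate t) P
    = map_mx (precomp_dilate t) P by rewrite -map_mxM PP.
have P1 : map_mx (precomp_dilate 1) P = P.
  by apply/matrixP => i j; rewrite mxE; apply/val_inj/funext => z;
    rewrite /= dilate1.
rewrite -P1.
apply: (@locally_constant_segment R
  (fun t => splits (map_mx (precomp_dilate t) P)) 0 1) => // [t|].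
- apply: filterS (near_transition_nonvanishing t PP) => s.
  move=> /nonvanishing_inverse[v dv]; apply: iff_sym.
  exact: splits_transition (idem t) (idem s) dv.
- have -> : map_mx (precomp_dilate 0) P =
      map_mx constant (map_mx (evaluation point) P).
    apply/matrixP => i j; rewrite !mxE; apply/val_inj/funext => z /=.
    by rewrite dilate0.
  by apply/splits_map/field_splits; rewrite -map_mxM PP.
Qed.

End Dilation.

Theorem corollary4p3 (R : realType) (d : nat) (hd : (0 < d)%N) :
  hermite_ring (sym_polydisc_algebra R d).
Proof. exact/hermite_of_splits/idempotent_splits. Qed.
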